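(* Triangle-free fractals are exactly triangle-free graphs of class 2. That is, a simple triangle-free graph $G$ is a fractal if and only if $G$ is of class 2, i.e. $\chi'(G)=\Delta(G)+1$.
   Context: $\chi'(G)$ is the chromatic index (edge chromatic number) and $\Delta(G)$ the maximum degree; by Vizing's theorem $\chi'(G)\in\{\Delta(G),\Delta(G)+1\}$; graphs with $\chi'=\Delta$ are of class 1, those with $\chi'=\Delta+1$ are of class 2. A clique $k$-cover of $G$ is a family of cliques of $G$ such that every edge of $G$ lies in at least one of them and every vertex belongs to at most $k$ of them. The rank dimension $\dim_R(G)$ is the minimal $k$ such that $G$ has a clique $k$-cover (equivalently, $G$ is the intersection graph of the edges of a hypergraph of rank at most $k$, where the rank is the maximal size of an edge). The categorical product $G_1\times G_2$ has vertex set $V(G_1)\times V(G_2)$, with $(u_1,u_2),(v_1,v_2)$ adjacent iff $u_1v_1\in E(G_1)$ and $u_2v_2\in E(G_2)$. The Prague dimension $\dim_P(H)$ is the minimal integer $d$ such that $H$ is isomorphic to an induced subgraph of a categorical product of $d$ complete graphs. Put $\dim_L(G)=\dim_R(G)-1$ (Lebesgue dimension) and $\dim_H(G)=\dim_P(\overline{G})-1$ (Hausdorff dimension), where $\overline G$ is the complement of $G$. The graph $G$ is a fractal if $\dim_L(G)<\dim_H(G)$, i.e. $\dim_R(G)<\dim_P(\overline{G})$.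
   Formalization: Graphs with Δ(G)=1 are excluded, since each is a fractal of class 1 (K_2: dim_R=1, dim_P of its complement is 2, χ'=1); dim_R is taken as the least positive k, which matters only for edgeless graphs. *)

(* Defs.v *)
From HB Require Import structures.
From mathcomp Require Import all_boot all_order all_algebra.
From mathcomp Require Import boolp.

Set Implicit Arguments.
Unset Strict Implicit.
Unset Printing Implicit Defensive.

Record sgraph := SGraph {
  vert :> finType;
  adj : rel vert;
  adj_sym : symmetric adj;
  adj_irr : irreflexive adj }.

Section Constructions.

Lemma compl_sym (G : sgraph) :
  symmetric [rel x y : G | (x != y) && ~~ adj x y].
Proof. by move=> x y /=; rewrite eq_sym adj_sym. Qed.

Lemma compl_irr (G : sgraph) :
  irreflexive [rel x y : G | (x != y) && ~~ adj x y].
Proof. by move=> x /=; rewrite eqxx. Qed.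

Definition compl (G : sgraph) : sgraph := SGraph (@compl_sym G) (@compl_irr G).

Lemma complete_sym n : symmetric [rel i j : 'I_n | i != j].
Proof. by move=> x y /=; rewrite eq_sym. Qed.

Lemma complete_irr n : irreflexive [rel i j : 'I_n | i != j].
Proof. by move=> x /=; rewrite eqxx. Qed.

Definition complete (n : nat) : sgraph :=
  SGraph (@complete_sym n) (@complete_irr n).

Lemma cat_prod_sym (G1 G2 : sgraph) :
  symmetric [rel u v : G1 * G2 | adj u.1 v.1 && adj u.2 v.2].
Proof. by move=> u v /=; rewrite adj_sym [X in _ && X]adj_sym. Qed.

Lemma cat_prod_irr (G1 G2 : sgraph) :
  irreflexive [rel u v : G1 * G2 | adj u.1 v.1 && adj u.2 v.2].
Proof. by move=> u /=; rewrite adj_irr. Qed.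

Definition cat_prod (G1 G2 : sgraph) : sgraph :=
  SGraph (@cat_prod_sym G1 G2) (@cat_prod_irr G1 G2).

Lemma induced_sym (G : sgraph) (A : {set G}) :
  symmetric [rel x y : {x : G | x \in A} | adj (val x) (val y)].
Proof. by move=> x y /=; rewrite adj_sym. Qed.

Lemma induced_irr (G : sgraph) (A : {set G}) :
  irreflexive [rel x y : {x : G | x \in A} | adj (val x) (val y)].
Proof. by move=> x /=; rewrite adj_irr. Qed.

Definition induced (G : sgraph) (A : {set G}) : sgraph :=
  SGraph (@induced_sym G A) (@induced_irr G A).

End Constructions.

Definition isomorphic (G H : sgraph) : Prop :=
  exists2 f : G -> H, bijective f & forall x y, adj (f x) (f y) = adj x y.

Definition triangle_free (G : sgraph) : Prop :=
  forall x y z : G, ~~ [&& adj x y, adj y z & adj x z].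

Definition max_degree (G : sgraph) : nat :=
  \max_(x : G) #|[set y | adj x y]|.

Definition edges (G : sgraph) : {set {set G}} :=
  [set [set p.1; p.2] | p : G * G & adj p.1 p.2].

(* Colours are natural numbers below [k] rather than elements of ['I_k], so that
   an edgeless graph is 0-edge-colourable; [c] is irrelevant off [edges G]. *)
Definition edge_colourable (G : sgraph) (k : nat) : Prop :=
  exists c : {set G} -> nat,
    {in edges G, forall e : {set G}, c e < k} /\
    {in edges G &, forall e e' : {set G},
      e != e' -> ~~ [disjoint e & e'] -> c e != c e'}.

Lemma edge_colourable_ex (G : sgraph) : exists k, `[< edge_colourable G k >].
Proof.
exists #|edges G|; apply/asboolP; exists (index^~ (enum (edges G))).
split=> [e eE|e e' eE e'E ee' _]; first by rewrite cardE index_mem mem_enum.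
by apply: contra ee' => /eqP /index_inj-> //; rewrite mem_enum.
Qed.

Definition chromatic_index (G : sgraph) : nat := ex_minn (edge_colourable_ex G).

Definition class2 (G : sgraph) : Prop :=
  chromatic_index G = (max_degree G).+1.

Definition clique (G : sgraph) (Q : {set G}) : Prop :=
  {in Q &, forall x y, x != y -> adj x y}.

Definition clique_cover (G : sgraph) (k : nat) (F : {set {set G}}) : Prop :=
  [/\ {in F, forall Q, clique Q},
      forall x y : G, adj x y -> exists2 Q, Q \in F & (x \in Q) && (y \in Q)
    & forall x : G, #|[set Q in F | x \in Q]| <= k].

Lemma rank_dim_ex (G : sgraph) :
  exists k, `[< 0 < k /\ exists F : {set {set G}}, clique_cover k F >].
Proof.
exists #|edges G|.+1; apply/asboolP; split=> //; exists (edges G); split.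
- move=> _ /imsetP[[a b] /= ab ->] x y; rewrite !inE /=; rewrite inE /= in ab.
  by do 2![case/orP=> /eqP->]; rewrite ?eqxx // ?[adj b a]adj_sym.
- move=> x y xy; exists [set x; y]; last by rewrite !inE !eqxx orbT.
  by apply/imsetP; exists (x, y); rewrite ?inE.
move=> x; apply: leqW; apply: subset_leq_card.
by apply/subsetP=> Q; rewrite inE => /andP[].
Qed.

(* The minimum is over positive [k]: edges of a hypergraph are nonempty, so its
   rank is at least 1.  This matters only for edgeless graphs, which the empty
   family covers; they get rank dimension 1 and Lebesgue dimension 0. *)
Definition rank_dim (G : sgraph) : nat := ex_minn (rank_dim_ex G).

(* [K_n * K_(s_1) * ... * K_(s_m)], a product of [size s + 1] complete graphs. *)
Fixpoint prod_complete (n : nat) (s : seq nat) : sgraph :=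
  if s is m :: s' then cat_prod (complete n) (prod_complete m s')
  else complete n.

Definition prague_embeddable (H : sgraph) (d : nat) : Prop :=
  exists n s, (size s).+1 = d /\
    exists A : {set prod_complete n s}, isomorphic H (induced A).

Lemma embed_isomorphic (H K : sgraph) (f : H -> K) :
  injective f -> (forall x y, adj (f x) (f y) = adj x y) ->
  exists A : {set K}, isomorphic H (induced A).
Proof.
move=> f_inj fE; pose A := [set f x | x in [set: H]].
have fA x : f x \in A by apply: imset_f.
exists A, (fun x => exist _ (f x) (fA x) : induced A); last by move=> x y; apply: fE.
apply: inj_card_bij => [x y [/f_inj]//|].
by rewrite card_sig -[X in _ <= X]cardsT -(card_imset _ f_inj) subset_leq_card.
Qed.

Lemma prod_complete_map (T : finType) n (f : T -> 'I_n) (fs : seq (T -> 'I_n)) :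
  exists F : T -> prod_complete n (map (fun=> n) fs),
    (forall x y, F x = F y -> f x = f y) /\
    (forall x y, adj (F x) (F y) = all (fun g => g x != g y) (f :: fs)).
Proof.
elim: fs f => [|g fs IH] f; first by exists f; split=> // x y /=; rewrite andbT.
have [F [Finj FE]] := IH g; exists (fun x => (f x, F x)); split=> [x y []//|x y].
by rewrite /= FE.
Qed.

(* One injective coordinate, and one coordinate merging each pair of distinct
   nonadjacent vertices. *)
Lemma prague_dim_ex (H : sgraph) : exists d, `[< prague_embeddable H d >].
Proof.
pose merge (p : H * H) (x : H) :=
  enum_rank (if (x == p.2) && ~~ adj p.1 p.2 then p.1 else x).
have [F [Finj FE]] :=
  prod_complete_map (enum_rank : H -> 'I_#|H|) (map merge (enum {: H * H})).
eexists; apply/asboolP; eexists; eexists; split; first by [].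
apply: (@embed_isomorphic _ _ F) => [x y /Finj /enum_rank_inj//|x y].
rewrite FE /= (inj_eq enum_rank_inj).
case: (eqVneq x y) => [->|xy] /=; first by rewrite adj_irr.
apply/allP/idP => [h|axy _ /mapP[[u v] _ ->]].
  have /h : merge (x, y) \in map merge (enum {: H * H}).
    by apply: map_f; rewrite mem_enum.
  by rewrite /merge /= eqxx (negbTE xy) /=; case: (adj x y) => //; rewrite eqxx.
rewrite /merge /= (inj_eq enum_rank_inj).
case: (eqVneq x v) => [xv|xv]; case: (eqVneq y v) => [yv|yv] //=.
- by move: xy; rewrite xv yv eqxx.
- by case: ifP => // nuv; apply: contraNneq nuv => ->; rewrite -xv adj_sym.
- by case: ifP => // nuv; apply: contraNneq nuv => <-; rewrite -yv.
Qed.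

Definition prague_dim (H : sgraph) : nat := ex_minn (prague_dim_ex H).

Local Open Scope ring_scope.

Definition lebesgue_dim (G : sgraph) : int := (rank_dim G)%:Z - 1.

Definition hausdorff_dim (G : sgraph) : int := (prague_dim (compl G))%:Z - 1.

Definition fractal (G : sgraph) : Prop := lebesgue_dim G < hausdorff_dim G.

(* Main.v *)
(* A clique of a triangle-free graph G has at most two vertices, so a clique
   cover contains every edge of G, and dim_R(G) = Delta(G) as soon as G has an
   edge.  An embedding of the complement of G into a product of d complete
   graphs amounts to d maps on V(G), jointly injective, such that two distinct
   vertices are adjacent in G iff some map identifies them.  The fibres are then
   cliques, so each map contracts a matching of G and the d matchings form an
   edge colouring; conversely contracting the colour classes is jointly injective
   once there are two colours, hence dim_P = chi'(G) when Delta(G) >= 2.  Thus G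
   is a fractal iff Delta(G) < chi'(G), which by Vizing's theorem is class 2.
   Vizing's theorem is proved with fans and Kempe chains. *)
Require Import Defs.
From mathcomp Require Import all_boot all_algebra perm zify boolp.

Set Implicit Arguments.
Unset Strict Implicit.
Unset Printing Implicit Defensive.

(** * Orbit of a fixed point of one of two involutions *)

Section DihedralOrbit.
Variables (T : finType) (A B : T -> T).
Hypotheses (AK : involutive A) (BK : involutive B).
Variable (x : T).
Hypothesis Ax : A x = x.

Let s := B \o A.

(* Identifying the [s]-orbit of [x] with Z/m by n |-> s^n x, [A] acts as
   n |-> -n and [B] as n |-> 1 - n; so besides [x] only the index
   ceil(m / 2) can be fixed by [A] or by [B]. *)
Lemma reflect_iter n : iter n s (A (iter n s x)) = x.
Proof. by elim: n => [//|n IHn]; rewrite [iter _ _ x]iterS iterSr /s /= AK BK. Qed.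

Lemma reflect_iterS n : iter n s (B (iter n.+1 s x)) = x.
Proof. by rewrite iterS /s /= BK reflect_iter. Qed.

Lemma rotation_inj : injective s.
Proof. by apply: inj_comp; [apply: inv_inj | apply: inv_inj]. Qed.

Lemma iter_order_fix n : 0 < n < (order s x).*2 -> iter n s x = x -> n = order s x.
Proof.
have iter0 m : m < order s x -> iter m s x = x -> m = 0.
  by move=> lt_m fixm; rewrite -(findex_iter lt_m) fixm findex0.
move=> /andP[n_gt0 n_lt] fixn.
case: (ltnP n (order s x)) => [/iter0/(_ fixn)|le_n]; first lia.
suff: n - order s x = 0 by lia.
apply: iter0; first by lia.
rewrite -[RHS]fixn -{2}(subnK le_n) iterD.
by rewrite (iter_order rotation_inj).
Qed.

Lemma fixed_index y : fconnect s x y -> y != x -> (A y == y) || (B y == y) ->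
  findex s x y = (order s x).+1./2.
Proof.
move=> xy yx fixy; have yE := iter_findex xy; have := findex_max xy.
set n := findex s x y in yE * => lt_n.
have n_gt0 : 0 < n by case: n yE {lt_n} => // /= xE; rewrite xE eqxx in yx.
(* With m the order, a fixed point of [A] gives s^(2n) x = x, hence m = 2n; one of [B] gives m = 2n
   - 1. Both exponents are below 2m. *)
case/orP: fixy => /eqP fixy.
  have := reflect_iter n; rewrite yE fixy -yE -iterD addnn => /iter_order_fix; lia.
have := reflect_iterS n.-1; rewrite prednK // yE fixy -yE -iterD.
by move/iter_order_fix; lia.
Qed.

Lemma orbit_closed (y : T) : fconnect s x y -> fconnect s x (A y) /\ fconnect s x (B y).
Proof.
have sym := fconnect_sym rotation_inj.
move=> xy; rewrite -(iter_findex xy); set n := findex _ _ _.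
have cA m : fconnect s x (A (iter m s x)).
  by rewrite sym -{2}(reflect_iter m) fconnect_iter.
split=> //; case: n => [|n]; last first.
  by rewrite sym -{2}(reflect_iterS n) fconnect_iter.
(* At index 0, [B x = B (A x) = s x]. *)
by rewrite /= -{2}Ax; apply: fconnect1.
Qed.

End DihedralOrbit.

(** * Partial edge colourings and Kempe chains *)

Section EdgeColouring.
Variables (V : finType) (k : nat).
Implicit Types (c : V -> V -> option 'I_k) (a b : 'I_k).

(** [None] marks nonedges and uncoloured edges alike, so no graph is mentioned. *)
Definition proper c : Prop :=
  (forall x y, c x y = c y x) /\
  (forall x y z a, c x y = Some a -> c x z = Some a -> y = z).

Definition misses c x a : bool := [forall y, c x y != Some a].

Lemma missesP c x a : reflect (forall y, c x y <> Some a) (misses c x a).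
Proof. by apply: (iffP forallP) => h y; apply/eqP/h. Qed.

(** The default [x] turns the matching of colour [a] into an involution of all of [V] that fixes the
    vertices missing [a]. *)
Definition mate c a x : V := odflt x [pick y | c x y == Some a].

Lemma mateK c a : proper c -> involutive (mate c a).
Proof.
move=> [csym cinj] x; rewrite /mate; case: pickP => [y /eqP xy|h] /=.
  case: pickP => [z /eqP yz|/(_ x)]; last by rewrite csym xy eqxx.
  by rewrite csym in xy; apply: (cinj _ _ _ _ yz xy).
by case: pickP => // z; rewrite h.
Qed.

Lemma mate_misses c a x : misses c x a -> mate c a x = x.
Proof. by move/missesP=> m; rewrite /mate; case: pickP => // y /eqP/m. Qed.

Lemma mate_edge c a x y : proper c -> c x y = Some a -> mate c a x = y.
Proof.
move=> [_ cinj] xy; rewrite /mate; case: pickP => [z /eqP xz|/(_ y)].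
  exact: cinj xz xy.
by rewrite xy eqxx.
Qed.

Definition chain_adj c a b : rel V :=
  [rel x y | (c x y == Some a) || (c x y == Some b)].

Lemma chain_sym c a b : proper c -> connect_sym (chain_adj c a b).
Proof.
by move=> [csym _]; apply: sym_connect_sym => x y; rewrite /chain_adj /= csym.
Qed.

(* The chain through [x] is the orbit of [x] under the dihedral group of the
   two matchings, so it has at most one end other than [x]. *)
Lemma chain_ends c a b x y z : proper c -> misses c x a ->
  misses c y a || misses c y b -> misses c z a || misses c z b ->
  y != x -> z != x -> connect (chain_adj c a b) x y ->
  connect (chain_adj c a b) x z -> y = z.
Proof.
move=> cP xa yab zab yx zx xy xz.
have [AK BK] := (mateK a cP, mateK b cP); have Ax := mate_misses xa.
pose s := mate c b \o mate c a.
have sub w : connect (chain_adj c a b) x w -> fconnect s x w.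
  case/connectP=> p; elim/last_ind: p w => [|p u IHp] w /=; first by move=> _ ->.
  rewrite rcons_path last_rcons => /andP[/IHp/(_ erefl) /(orbit_closed AK BK Ax)[hA hB] e ->].
  by case/orP: e => /eqP /(mate_edge cP) <-.
have fixed w : misses c w a || misses c w b -> (mate c a w == w) || (mate c b w == w).
  by case/orP => /mate_misses ->; rewrite eqxx ?orbT.
rewrite -(iter_findex (sub _ xy)) -(iter_findex (sub _ xz)).
by rewrite !(fixed_index AK BK Ax) ?sub ?fixed.
Qed.

Definition kempe c a b w : V -> V -> option 'I_k := fun x y =>
  if connect (chain_adj c a b) w x then omap (tperm a b) (c x y) else c x y.

(** [kempe] tests only its first vertex; symmetry survives because an edge of colour [a] or [b] lies
    in one chain and the swap fixes the other colours. *)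
Lemma kempe_proper c a b w : proper c -> proper (kempe c a b w).
Proof.
move=> cP; have [csym cinj] := cP; split=> [x y|x y z d].
  rewrite /kempe -(csym x y).
  have [xy|nxy] := boolP (chain_adj c a b x y).
    by rewrite (same_connect_r (chain_sym _ _ cP) (connect1 xy)).
  suff -> : omap (tperm a b) (c x y) = c x y by do 2![case: ifP].
  move: nxy; rewrite /chain_adj /=; case: (c x y) => //= d.
  by rewrite negb_or => /andP[da db]; rewrite tpermD // eq_sym.
rewrite /kempe; case: ifP => _; last exact: cinj.
case xy: (c x y) => [i|] //= [<-]; case xz: (c x z) => [j|] //= [/perm_inj ij].
by rewrite ij in xz; apply: cinj xy xz.
Qed.

Lemma kempe_support c a b w x y : (kempe c a b w x y == None) = (c x y == None).
Proof. by rewrite /kempe; case: ifP => //; case: (c x y). Qed.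

Lemma kempe_out c a b w x y : ~~ connect (chain_adj c a b) w x ->
  kempe c a b w x y = c x y.
Proof. by rewrite /kempe => /negbTE ->. Qed.

Lemma kempe_misses_out c a b w x d : ~~ connect (chain_adj c a b) w x ->
  misses c x d -> misses (kempe c a b w) x d.
Proof. by move=> nx /missesP m; apply/missesP=> y; rewrite kempe_out. Qed.

Lemma kempe_misses_other c a b w x d : d != a -> d != b ->
  misses c x d -> misses (kempe c a b w) x d.
Proof.
move=> da db /missesP m; apply/missesP=> y; rewrite /kempe; case: ifP => // _.
case E: (c x y) => [i|] //= [] iE; apply: (m y); rewrite E -iE.
by move: iE; case: tpermP => [->|->|//] h; rewrite h eqxx in da db.
Qed.

Lemma kempe_misses_start c a b w :
  misses c w b -> misses (kempe c a b w) w a.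
Proof.
move=> /missesP m; apply/missesP=> y; rewrite /kempe connect0.
case E: (c w y) => [i|] //= [] iE; apply: (m y).
by rewrite E -[i](tpermK a b) iE tpermL.
Qed.

(** * Fans, and extending a colouring by one edge *)

(** Only the set of coloured edges is prescribed; [c'] may change colours already given. *)
Definition extends_at c x y c' :=
  proper c' /\ forall u v, (c' u v == None) =
    (c u v == None) && ~~ [|| (u == x) && (v == y) | (u == y) && (v == x)].

Definition fan_step c x : rel V :=
  [rel y z | if c x z is Some d then misses c y d else false].

Definition recolour c x y o : V -> V -> option 'I_k := fun u v =>
  if [|| (u == x) && (v == y) | (u == y) && (v == x)] then o else c u v.

Lemma recolour_proper c x y o : proper c -> x != y ->
  (forall d, o = Some d -> misses c x d /\ misses c y d) ->
  proper (recolour c x y o).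
Proof.
move=> [csym cinj] xy om; split=> [u v|u v w d]; rewrite /recolour.
  by rewrite orbC [(v == x) && _]andbC [(v == y) && _]andbC csym.
case: ifP => [E1 oE|E1].
  have [/missesP mx /missesP my] := om _ oE.
  case: ifP => [E2 _|E2 uw].
    move: E1 E2; case: (eqVneq u x) => [->|ux] /=.
      by rewrite (negbTE xy) !orbF => /eqP-> /eqP->.
    by case: (eqVneq u y) => //= _ /eqP -> /eqP ->.
  by case/orP: E1 => /andP[/eqP uE _]; rewrite uE in uw; [case: (mx w)|case: (my w)].
case: ifP => [E2 uv oE|_]; last exact: cinj.
have [/missesP mx /missesP my] := om _ oE.
by case/orP: E2 => /andP[/eqP uE _]; rewrite uE in uv; [case: (mx v)|case: (my v)].
Qed.

(* Shift the colours of the fan one step towards its root, which leaves the last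
   edge of the fan uncoloured. *)
Lemma fan_shift c x y s a : proper c -> c x y = None ->
  path (fan_step c x) y s -> uniq (y :: s) -> x \notin y :: s ->
  misses c x a -> misses c (last y s) a -> exists c', extends_at c x y c'.
Proof.
elim: s c y => [|z s IHs] c y cP cxy.
  rewrite inE /= => _ _ xy mx my; exists (recolour c x y (Some a)).
  split; first by apply: recolour_proper => // d [<-].
  move=> u v; rewrite /recolour; case: ifP => _; first by rewrite andbF.
  by rewrite andbT.
rewrite [path _ _ _]/= => /andP[yz ps] /=; rewrite !inE !negb_or.
move=> /and3P[/andP[neyz ys] zs us] /and3P[xy xz xs] mx ml.
move: yz; rewrite /fan_step /=; case cxz: (c x z) => [d|] // yd.
(* [c0] vacates [xz], which frees [d] at [x]; [c1] gives [d] to [xy], and the rest of the fan starts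
   at [z]. *)
pose c0 := recolour c x z None; pose c1 := recolour c0 x y (Some d).
have c0P : proper c0 by apply: recolour_proper.
have mono u e : misses c u e -> misses c0 u e.
  by move=> /missesP m; apply/missesP=> v; rewrite /c0 /recolour; case: ifP.
have [csym cinj] := cP.
have xd : misses c0 x d.
  apply/missesP=> v; rewrite /c0 /recolour eqxx /= (negbTE xz) orbF.
  by case: ifP => // /eqP vz /(cinj _ _ _ _ cxz) zv; rewrite zv in vz.
have c1P : proper c1 by apply: recolour_proper => // e [<-]; split=> //; apply: mono.
have c1x v : v != y -> v != z -> c1 x v = c x v.
  move=> vy vz; rewrite /c1 /c0 /recolour eqxx (negbTE vy) (negbTE vz) /=.
  by rewrite (negbTE xy) (negbTE xz).
have c1m u e : u != y -> u != x -> misses c u e -> misses c1 u e.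
  move=> uy ux m; apply/missesP=> v; rewrite /c1 {1}/recolour (negbTE uy) (negbTE ux) /=.
  exact/missesP/mono.
have cxz1 : c1 x z = None.
  by rewrite /c1 /c0 /recolour !eqxx /= (eq_sym z) (negbTE neyz) (negbTE xy).
have xa1 : misses c1 x a.
  have da : d != a by apply: contraTneq mx => <-; apply/negP=> /missesP/(_ z).
  apply/missesP=> v; rewrite /c1 {1}/recolour; case: ifP => _.
    by case=> E; rewrite E eqxx in da.
  exact/missesP/mono.
(* Spokes beyond [z] keep their colours, and vertices other than [x] and [y] still miss what they
   missed. *)
have ps1 : path (fan_step c1 x) z s.
  have zsP : all [pred u | (u != y) && (u != x)] (z :: s).
    apply/allP=> u; rewrite inE => /predU1P[->|us'] /=.
      by rewrite eq_sym neyz eq_sym.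
    by apply/andP; split; [move: ys|move: xs]; apply: contraNneq => <-.
  have sP : all [pred u | (u != y) && (u != z)] s.
    by apply/allP=> u us' /=; apply/andP; split; [move: ys|move: zs]; apply: contraNneq => <-.
  move: zsP ps; move: {1 2 3}z => w.
  elim: s w sP {IHs ys zs us xs ml} => //= u s IHs w /andP[/andP[uy uz] sP].
  case/andP=> /andP[wy wx] usP /andP[wu ps]; rewrite IHs // andbT.
  rewrite /fan_step /= in wu *; rewrite c1x //.
  by case: (c x u) wu => // e; apply: c1m.
have la1 : misses c1 (last z s) a.
  have: last z s \in z :: s by apply: mem_last.
  move=> lzs; apply: c1m => //; move: lzs; rewrite inE; apply: contraTneq => ->.
    by rewrite negb_or neyz.
  by rewrite negb_or xz.
have [||c' [c'P c'E]] := IHs c1 z c1P cxz1 ps1 _ _ xa1 la1.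
- by rewrite /= zs.
- by rewrite inE negb_or xz.
exists c'; split=> // u v; rewrite c'E /c1 /c0 /recolour.
case: (boolP ((u == x) && _ || _)) => [|_] /=; first by rewrite andbF.
case: (boolP ((u == x) && (v == z) || _)) => [|_]; rewrite ?andbF ?andbT //.
case/orP=> /andP[/eqP-> /eqP->]; first by rewrite cxz.
by rewrite csym cxz.
Qed.

(* Away from [z], the fan uses neither [a] (missing at its centre [x]) nor [b]
   (the colour of [xz]), so swapping these two colours preserves it. *)
Lemma kempe_fan c a b v x y z s : proper c -> misses c x a -> c x z = Some b ->
  ~~ connect (chain_adj c a b) v x -> z \notin s ->
  path (fan_step c x) y s -> path (fan_step (kempe c a b v) x) y s.
Proof.
move=> [_ cinj] /missesP xa xz vx; elim: s y => //= u s IHs y.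
rewrite inE negb_or => /andP[zu zs] /andP[yu us]; rewrite IHs // andbT.
move: yu; rewrite /fan_step /= kempe_out //; case xu: (c x u) => [d|] //.
apply: kempe_misses_other; first by apply/eqP=> da; case: (xa u); rewrite xu da.
by apply: contraNneq zu => db; rewrite db in xu; rewrite (cinj _ _ _ _ xz xu).
Qed.

Lemma extends_kempe c a b w x y c' :
  extends_at (kempe c a b w) x y c' -> extends_at c x y c'.
Proof. by case=> c'P c'E; split=> // u v; rewrite c'E kempe_support. Qed.

(** Grow a fan at [x] until a colour missing at its last vertex is missing at [x] too, so the fan
    can be shifted, or is already the colour of a spoke, so a chain must be swapped first. *)
Lemma vizing_step c x y : proper c -> (forall u, exists a, misses c u a) ->
  c x x = None -> x != y -> c x y = None -> exists c', extends_at c x y c'.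
Proof.
move=> cP miss cxx xy cxy; have [_ cinj] := cP.
have [a xa] := miss x.
(* [n] bounds the further growth; the fan must stop because its vertices are distinct. *)
suff: forall n s, #|V| <= size s + n -> path (fan_step c x) y s ->
    uniq (y :: s) -> x \notin y :: s -> exists c', extends_at c x y c'.
  by move/(_ #|V| [::]); apply => //; rewrite inE.
elim=> [|n IHn] s le_s ps us xs.
  have := max_card (mem (y :: s)); have /card_uniqP -> := us.
  by rewrite addn0 in le_s; rewrite leqNgt ltnS le_s.
have [b lb] := miss (last y s).
have [xb|/forallPn[z /negPn /eqP xz]] := boolP (misses c x b).
  exact: fan_shift cP cxy ps us xs xb lb.
have [zs|zs] := boolP (z \in y :: s); last first.
  apply: (IHn (rcons s z)); first by rewrite size_rcons; lia.
  - by rewrite rcons_path ps /fan_step /= xz.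
  - by rewrite -rcons_cons rcons_uniq zs.
  rewrite -rcons_cons mem_rcons inE negb_or xs andbT.
  by apply/eqP=> xzE; rewrite -xzE cxx in xz.
have {zs} zs : z \in s by case/predU1P: zs => // zy; rewrite zy cxy in xz.
case/splitPr: zs le_s ps us xs lb => s1 s2 _.
rewrite cat_path last_cat => /andP[ps1 /andP[pz ps2]].
rewrite -!cat_cons mem_cat cat_uniq negb_or.
move=> /and3P[us1 dis us2] /andP[xs1 xs2] lb.
have zs1 : z \notin y :: s1 by move: dis; rewrite /= negb_or => /andP[].
have zs2 : z \notin s2 by case/andP: us2.
have pb : misses c (last y s1) b by move: pz; rewrite /fan_step /= xz.
have px : last y s1 != x by apply: contraNneq xs1 => <-; apply: mem_last.
have lx : last z s2 != x by apply: contraNneq xs2 => <-; apply: mem_last.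
have pl : last y s1 != last z s2.
  apply: contraNneq dis => E; apply/hasP; exists (last z s2); first exact: mem_last.
  by rewrite -E mem_last.
have csym := chain_sym a b cP.
(* [x], [last y s1] and [last z s2] are all ends of a/b-chains, so one of the
   latter two is not in the chain of [x]; swapping the chain of that one frees
   [a] at both ends of a fan. *)
have [xp|xp] := boolP (connect (chain_adj c a b) x (last y s1)).
  have lx' : ~~ connect (chain_adj c a b) (last z s2) x.
    apply: contra pl; rewrite csym => xl; apply/eqP.
    by apply: (chain_ends (b := b) cP xa) => //; rewrite ?pb ?lb ?orbT.
  have [|||||||c' c'P] := @fan_shift (kempe c a b (last z s2)) x y (s1 ++ z :: s2) a.
  - exact: kempe_proper.
  - by rewrite kempe_out.
  - rewrite cat_path /= !(kempe_fan cP xa xz) //; last by move: zs1; rewrite inE negb_or => /andP[].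
    (* The link from [last y s1] to [z] survives: [last y s1] is in the chain of [x], which is not
       swapped. *)
    rewrite /fan_step /= kempe_out // xz andbT; apply: kempe_misses_out => //.
    by apply: contra lx' => /connect_trans; apply; rewrite csym.
  - by rewrite -cat_cons cat_uniq us1 dis us2.
  - by rewrite -cat_cons mem_cat negb_or xs1.
  - exact: kempe_misses_out.
  - by rewrite last_cat /=; apply: kempe_misses_start.
  by exists c'; apply: extends_kempe c'P.
rewrite csym in xp.
have [|||||||c' c'P] := @fan_shift (kempe c a b (last y s1)) x y s1 a => //.
- exact: kempe_proper.
- by rewrite kempe_out.
- by apply: (kempe_fan cP xa xz) => //; move: zs1; rewrite inE negb_or => /andP[].
- exact: kempe_misses_out.
- exact: kempe_misses_start.
by exists c'; apply: extends_kempe c'P.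
Qed.

Lemma mateP c a u : ~~ misses c u a -> c u (mate c a u) = Some a.
Proof.
by rewrite /mate => /forallPn[v /negPn uv]; case: pickP => [w /eqP//|/(_ v)]; rewrite uv.
Qed.

(** If every colour occurred at [u], [mate] would inject the [k] colours into the coloured
    neighbours of [u]. *)
Lemma missing_colour c (u : V) : #|[set v | c u v != None]| < k ->
  exists a, misses c u a.
Proof.
move=> deg_lt; apply/existsP; apply: contraLR deg_lt => /existsPn h; rewrite -leqNgt.
have uE a := mateP (h a).
have inj : injective (fun a => mate c a u).
  by move=> a b /= E; have := uE a; rewrite E uE => -[].
rewrite -[X in X <= _]card_ord -cardsT -(card_imset _ inj); apply: subset_leq_card.
by apply/subsetP=> _ /imsetP[a _ ->]; rewrite inE uE.
Qed.
End EdgeColouring.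

(** * Vizing's theorem *)

Section Graphs.
Variable G : sgraph.

Lemma leq_max_degree (x : G) : #|[set y | adj x y]| <= max_degree G.
Proof. exact: leq_bigmax. Qed.

Lemma max_degree0_adj (x y : G) : max_degree G = 0 -> adj x y = false.
Proof.
move=> deg0; have := leq_max_degree x.
by rewrite deg0 leqn0 => /eqP/cards0_eq/setP/(_ y); rewrite !inE.
Qed.

Lemma vizing_colouring : exists c : G -> G -> option 'I_(max_degree G).+1,
  proper c /\ forall x y, (c x y != None) = adj x y.
Proof.
(* Induction on a bound for the number of uncoloured adjacent ordered pairs, starting from the empty
   colouring. *)
suff aug : forall n (c : G -> G -> option 'I_(max_degree G).+1), proper c ->
    (forall x y, c x y != None -> adj x y) ->
    #|[set p | adj p.1 p.2 && (c p.1 p.2 == None)]| <= n ->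
    exists c : G -> G -> option 'I_(max_degree G).+1,
      proper c /\ forall x y, (c x y != None) = adj x y.
  exact: (aug _ (fun _ _ => None)).
elim=> [|n IHn] c cP sub le_n; have [csym _] := cP.
  exists c; split=> // x y; apply/idP/idP => [/sub //|xy]; apply/negP=> cxy.
  by move: le_n; rewrite leqn0 => /eqP/cards0_eq/setP/(_ (x, y)); rewrite !inE xy cxy.
have [[x y]|h] := pickP [pred p : G * G | adj p.1 p.2 && (c p.1 p.2 == None)].
  move=> /= /andP[xy /eqP cxy].
  have nxy : x != y by apply: contraTneq xy => ->; rewrite adj_irr.
  have [||||c' [c'P c'E]] := @vizing_step G _ c x y cP.
  - move=> u; apply: missing_colour; rewrite ltnS.
    apply: leq_trans (leq_max_degree u); apply: subset_leq_card.
    by apply/subsetP=> v; rewrite !inE => /sub.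
  - by apply/eqP; apply: contraFT (adj_irr x) => /sub.
  - by [].
  - by [].
  apply: (IHn c' c'P) => [u v|].
    rewrite c'E negb_and negbK => /orP[/sub//|/orP[]/andP[/eqP-> /eqP->] //].
    by rewrite adj_sym.
  rewrite -ltnS; apply: leq_trans le_n; apply: proper_card; apply/properP; split.
    by apply/subsetP=> p; rewrite !inE c'E => /and3P[-> -> _].
  by exists (x, y); rewrite !inE /= ?c'E xy cxy !eqxx.
apply: (IHn c cP sub); rewrite (_ : [set _ | _] = set0) ?cards0 //.
by apply/setP=> p; rewrite !inE; apply: h.
Qed.

Lemma mem_edges (x y : G) : adj x y -> [set x; y] \in edges G.
Proof. by move=> xy; apply/imsetP; exists (x, y); rewrite ?inE. Qed.

Lemma edges_at (e : {set G}) (x : G) : e \in edges G -> x \in e ->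
  exists2 y, adj x y & e = [set x; y].
Proof.
move=> /imsetP[[u v] /= uv ->]; rewrite inE /= in uv.
rewrite !inE => /orP[]/eqP->; first by exists v.
by exists u; rewrite 1?adj_sym 1?setUC.
Qed.

Lemma set2_inj (x y z : G) : x != y -> [set x; y] = [set x; z] -> y = z.
Proof.
move=> xy /setP/(_ y); rewrite !inE eqxx orbT eq_sym (negbTE xy) /=.
by move/esym/eqP.
Qed.

Lemma adj_neq (x y : G) : adj x y -> x != y.
Proof. by apply: contraTneq => ->; rewrite adj_irr. Qed.

(** Fans and embeddings yield colours of vertex pairs, whereas the definition colours two-element
    sets. *)
Lemma edge_colourableP k : edge_colourable G k <->
  exists c : G -> G -> nat, [/\ forall x y, c x y = c y x,
    forall x y, adj x y -> c x y < k
    & forall x y z, adj x y -> adj x z -> c x y = c x z -> y = z].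
Proof.
split=> [[c [c_lt c_neq]]|[c [csym c_lt cinj]]].
  exists (fun x y => c [set x; y]); split=> [x y|x y /mem_edges|x y z xy xz].
  - by rewrite setUC.
  - exact: c_lt.
  move=> cE; apply: (set2_inj (adj_neq xy)); apply: contraPeq cE => ne; apply/eqP.
  apply: c_neq => //; try exact: mem_edges.
  by rewrite -setI_eq0; apply/set0Pn; exists x; rewrite !inE eqxx.
(* [pick] orients the edge, harmlessly since [c] is symmetric; 0 is a dummy value off [edges G]. *)
pose ce (e : {set G}) :=
  if [pick p | adj p.1 p.2 && (e == [set p.1; p.2])] is Some p then c p.1 p.2 else 0.
have ceE x y : adj x y -> ce [set x; y] = c x y.
  move=> xy; rewrite /ce; case: pickP => [[u v] /= /andP[uv /eqP E]|/(_ (x, y))].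
    have: u \in [set x; y] by rewrite E !inE eqxx.
    rewrite !inE => /orP[]/eqP ux; rewrite ux in E uv *.
      by rewrite (set2_inj (adj_neq xy) E).
    by rewrite setUC in E; rewrite -(set2_inj _ E) 1?csym // adj_neq // adj_sym.
  by rewrite /= xy eqxx.
exists ce; split=> [_ /imsetP[[x y] /= xy ->]|e e' eE e'E ne].
  by rewrite inE /= in xy; rewrite ceE // c_lt.
rewrite -setI_eq0 => /set0Pn[x]; rewrite inE => /andP[].
move=> /(edges_at eE)[y xy eq_e] /(edges_at e'E)[z xz eq_e'].
rewrite eq_e eq_e' !ceE //; apply: contraNneq ne => /cinj E.
by rewrite eq_e eq_e' E.
Qed.

Theorem vizing : edge_colourable G (max_degree G).+1.
Proof.
have [c [[csym cinj] cE]] := vizing_colouring.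
apply/edge_colourableP; exists (fun x y => if c x y is Some i then val i else 0).
split=> [x y|x y|x y z]; first by rewrite csym.
  by rewrite -cE; case: (c x y) => [i _|] //; apply: ltn_ord.
rewrite -!cE; case xy: (c x y) => [i|] // _; case xz: (c x z) => [j|] // _.
by move=> /val_inj ij; rewrite ij in xy; apply: cinj xy xz.
Qed.

Lemma chromatic_index_min k : edge_colourable G k -> chromatic_index G <= k.
Proof. by move=> ek; rewrite /chromatic_index; case: ex_minnP => m _; apply; apply/asboolP. Qed.

(** * Clique covers of triangle-free graphs *)

Lemma triangle_free_clique (Q : {set G}) (x y : G) : triangle_free G ->
  clique Q -> x \in Q -> y \in Q -> x != y -> Q = [set x; y].
Proof.
move=> tf Qc xQ yQ xy; apply/setP=> z; rewrite !inE.
apply/idP/orP=> [zQ|[]/eqP-> //].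
have [zx|zx] := eqVneq z x; first by left.
have [zy|zy] := eqVneq z y; first by right.
by have := tf x y z; rewrite !Qc // eq_sym.
Qed.

(** A clique containing both ends of an edge is that edge, so the members of [F] through [x] include
    every edge at [x]. *)
Lemma max_degree_cover k F : triangle_free G -> @clique_cover G k F ->
  max_degree G <= k.
Proof.
move=> tf [Fc Fcov Fk]; apply/bigmax_leqP=> x _; apply: leq_trans (Fk x).
have inj : {in [set y | adj x y] &, injective (fun y => [set x; y])}.
  by move=> y z; rewrite !inE => xy _; apply: set2_inj; apply: adj_neq.
rewrite -(card_in_imset inj); apply: subset_leq_card.
apply/subsetP=> _ /imsetP[y xy ->]; rewrite inE in xy.
have [Q QF /andP[xQ yQ]] := Fcov x y xy.
rewrite -(triangle_free_clique tf (Fc Q QF) xQ yQ (adj_neq xy)).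
by rewrite inE QF.
Qed.

Lemma edges_cover : clique_cover (max_degree G) (edges G).
Proof.
split=> [e eE x y xe ye xy|x y xy|x].
- have [z xz E] := edges_at eE xe; move: ye; rewrite E !inE eq_sym (negbTE xy).
  by move/eqP->.
- by exists [set x; y]; rewrite ?mem_edges // !inE !eqxx orbT.
apply: leq_trans (leq_max_degree x).
apply: leq_trans (leq_imset_card (fun y => [set x; y]) _); apply: subset_leq_card.
apply/subsetP=> e; rewrite inE => /andP[eE /(edges_at eE)[y xy ->]].
by apply: imset_f; rewrite inE.
Qed.

Lemma rank_dim_triangle_free : triangle_free G -> 0 < max_degree G ->
  rank_dim G = max_degree G.
Proof.
move=> tf deg_gt0; rewrite /rank_dim; case: ex_minnP => m /asboolP[_ [F FP]] mmin.
apply/eqP; rewrite eqn_leq (max_degree_cover tf FP) andbT.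
by apply: mmin; apply/asboolP; split=> //; exists (edges G); apply: edges_cover.
Qed.
End Graphs.

(** * Prague dimension of the complement *)

(** Values in [nat] let coordinates from factors of different sizes share one list. *)
Lemma prod_complete_coords n s : exists fs : seq (prod_complete n s -> nat),
  size fs = (size s).+1 /\ forall u v, adj u v = all (fun f => f u != f v) fs.
Proof.
elim: s n => [|m s IHs] n.
  by exists [:: val]; split=> // u v; rewrite /= andbT.
have [fs [sz fE]] := IHs m.
exists ((fun u => val u.1) :: map (fun f u => f u.2) fs); split; first by rewrite /= size_map sz.
by move=> u v; rewrite /= fE all_map.
Qed.

(** Contracting a matching is not injective by itself, so injectivity of [F] has to be drawn from
    agreement in several coordinates. *)
Lemma prod_complete_tuple (T : finType) n (f : T -> 'I_n) (fs : seq (T -> 'I_n)) :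
  exists F : T -> prod_complete n (map (fun=> n) fs),
    (forall x y, F x = F y -> all (fun g => g x == g y) (f :: fs)) /\
    (forall x y, adj (F x) (F y) = all (fun g => g x != g y) (f :: fs)).
Proof.
elim: fs f => [|g fs IH] f.
  by exists f; split=> x y; [move=> /= ->; rewrite eqxx | rewrite /= andbT].
have [F [Finj FE]] := IH g; exists (fun x => (f x, F x)); split=> [x y [fE /Finj h]|x y].
  by rewrite /= fE eqxx.
by rewrite /= FE.
Qed.

(** Colour an edge by the first coordinate identifying its ends. If [xy] and [xz] share a colour,
    that coordinate also identifies [y] and [z], which, if distinct, would close a triangle. *)
Lemma prague_colourable (G : sgraph) d : triangle_free G ->
  prague_embeddable (compl G) d -> edge_colourable G d.
Proof.
move=> tf [n [s [<- [A [g g_bij gE]]]]].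
have [fs [<- fE]] := prod_complete_coords n s.
pose h (x : G) := val (g x).
have hE (x y : G) : (x != y) && ~~ adj x y = all (fun f => f (h x) != f (h y)) fs.
  by rewrite -fE -[LHS](gE x y).
have adjE (x y : G) : x != y -> adj x y = has (fun f => f (h x) == f (h y)) fs.
  by move=> xy; apply: negb_inj; rewrite -all_predC -hE xy.
apply/edge_colourableP; exists (fun x y => find (fun f => f (h x) == f (h y)) fs).
split=> [x y|x y xy|x y z xy xz].
- by apply: eq_find => f; rewrite eq_sym.
- by rewrite -has_find -adjE // adj_neq.
have [nxy nxz] := (adj_neq xy, adj_neq xz).
move=> E; have [//|yz] := eqVneq y z; exfalso.
have /negP[] := tf x y z; rewrite xy xz andbT /= adjE //.
rewrite adjE // in xy; rewrite adjE // in xz.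
have := nth_find (fun=> 0) xz; have := nth_find (fun=> 0) xy.
rewrite -E /= => /eqP -> fxz; apply/hasP; eexists; last exact: fxz.
by rewrite mem_nth // -has_find.
Qed.

Lemma colourable_prague (G : sgraph) d : 1 < d ->
  edge_colourable G d -> prague_embeddable (compl G) d.
Proof.
case: d => [|d] // d_gt0 /edge_colourableP[c [csym c_lt cinj]].
(* Coordinate [i] of the embedding contracts the edges of colour [i]; joint
   injectivity needs a second colour. *)
pose cls i (x : G) : {set G} := [set y | (y == x) || (adj x y && (c x y == i))].
have clsE i x y : x != y -> (cls i x == cls i y) = adj x y && (c x y == i).
  move=> xy; apply/eqP/idP => [/setP/(_ y)|/andP[axy /eqP cxy]].
    by rewrite !inE eqxx eq_sym (negbTE xy).
  suff cls2 u v : adj u v -> c u v = i -> cls i u = [set u; v].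
    by rewrite (cls2 x y) // (cls2 y x) 1?setUC // 1?csym // adj_sym.
  move=> uv cuv; apply/setP=> w; rewrite !inE; congr (_ || _).
  apply/andP/eqP=> [[uw /eqP cuw]|->]; last by rewrite cuv uv.
  by apply: (cinj u) => //; rewrite cuv.
pose f i x : 'I_#|{set G}| := enum_rank (cls i x).
have fE i x y : x != y -> (f i x == f i y) = adj x y && (c x y == i).
  by move=> xy; rewrite (inj_eq enum_rank_inj) clsE.
have [F [Feq FE]] := prod_complete_tuple (f 0) (map f (iota 1 d)).
exists #|{set G}|, (map (fun=> #|{set G}|) (map f (iota 1 d))); split; last apply: (@embed_isomorphic (compl G) _ F).
- by rewrite !size_map size_iota.
(* Distinct vertices agreeing in coordinates 0 and 1 would span an edge having both colours. *)
- move=> x y /Feq; rewrite -(map_cons f) all_map => /allP h.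
  apply/eqP/idPn => xy.
  have /andP[_ /eqP c0] : @adj G x y && (c x y == 0) by rewrite -fE //; apply: h; rewrite mem_head.
  have : @adj G x y && (c x y == 1).
    by rewrite -fE //; apply: h; rewrite (mem_iota 0 d.+1).
  by rewrite c0 andbF.
move=> x y; rewrite FE -(map_cons f) all_map -[0 :: _]/(iota 0 d.+1).
have [->|xy] := eqVneq x y; first by rewrite /= !eqxx.
transitivity ((x != y) && ~~ @adj G x y) => //; rewrite xy andTb.
apply/allP/idP => [h|nadj i _]; last by rewrite /= fE // (negbTE nadj).
apply/negP=> adjxy; have := h (c x y).
by rewrite mem_iota c_lt // => /(_ isT) /=; rewrite fE // adjxy eqxx.
Qed.

Lemma colourable_gt1 (G : sgraph) d : 1 < max_degree G -> edge_colourable G d -> 1 < d.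
Proof.
move=> deg /edge_colourableP[c [_ c_lt cinj]].
have [x deg_x] : exists x : G, 1 < #|[set y | adj x y]|.
  apply/existsP; apply: contraLR deg => /existsPn h; rewrite -leqNgt.
  by apply/bigmax_leqP=> x _; rewrite leqNgt.
have [y [z []]] := card_gt1P deg_x; rewrite !inE => xy xz yz.
rewrite ltnNge; apply: contraNN yz => d_le1; apply/eqP/(cinj x) => //.
by have := c_lt _ _ xy; have := c_lt _ _ xz; lia.
Qed.

Lemma prague_dim_triangle_free (G : sgraph) : triangle_free G -> 1 < max_degree G ->
  prague_dim (compl G) = chromatic_index G.
Proof.
move=> tf deg; rewrite /prague_dim /chromatic_index.
case: ex_minnP => m /asboolP mP mmin; case: ex_minnP => n /asboolP nP nmin.
apply/eqP; rewrite eqn_leq mmin ?nmin //; apply/asboolP.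
  exact: prague_colourable.
by apply: colourable_prague => //; apply: colourable_gt1 nP.
Qed.

(** * Edgeless graphs and the final equivalence *)

Lemma prague_dim_edgeless (G : sgraph) : max_degree G = 0 -> prague_dim (compl G) <= 1.
Proof.
move=> deg0; rewrite /prague_dim; case: ex_minnP => m _; apply; apply/asboolP.
exists #|G|, [::]; split=> //.
apply: (@embed_isomorphic (compl G) (complete #|G|) enum_rank) => [|x y].
  exact: enum_rank_inj.
by rewrite /= (inj_eq enum_rank_inj) max_degree0_adj ?andbT.
Qed.

Lemma chromatic_index_edgeless (G : sgraph) : max_degree G = 0 -> chromatic_index G = 0.
Proof.
move=> deg0; apply/eqP; rewrite -leqn0; apply: chromatic_index_min.
apply/edge_colourableP; exists (fun _ _ => 0).
by split=> // x y; rewrite ?max_degree0_adj // => z; rewrite max_degree0_adj.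
Qed.

Lemma rank_dim_gt0 (G : sgraph) : 0 < rank_dim G.
Proof. by rewrite /rank_dim; case: ex_minnP => m /asboolP[]. Qed.

Lemma fractalE (G : sgraph) : fractal G <-> rank_dim G < prague_dim (compl G).
Proof. by rewrite /fractal /lebesgue_dim /hausdorff_dim; split; lia. Qed.

Theorem proposition6 (G : sgraph) (G_triangle_free : triangle_free G)
    (G_degree : max_degree G <> 1) :
  fractal G <-> class2 G.
Proof.
rewrite fractalE /class2.
have [deg0|deg_gt0] := posnP (max_degree G).
  (* Without edges both sides fail: dim_R >= 1 >= dim_P, and chi' = 0. *)
  rewrite deg0 chromatic_index_edgeless //.
  by have := rank_dim_gt0 G; have := prague_dim_edgeless deg0; lia.
(* Degree 1 is excluded: a single edge has dim_R = chi' = Delta = 1, yet its complement has Prague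
   dimension 2. *)
have deg : 1 < max_degree G by lia.
rewrite rank_dim_triangle_free // prague_dim_triangle_free //.
(* The claim is now that Delta < chi' iff chi' = Delta + 1. *)
by have := chromatic_index_min (vizing G); lia.
Qed.
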